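(* Let $\eta\in(0,1)$ and let the joint (approximate) best-response map $\widehat{BR}_\Phi:\mathcal{C}_u\rightrightarrows\mathcal{C}_u$ described in the context be $L_{\widehat{BR}_\Phi}$-Lipschitz with $L_{\widehat{BR}_\Phi}<1$. Then the system-level best-response dynamics $$\Phi_{u,k+1}=\widehat T_\Phi(\Phi_{u,k}),\qquad\widehat T_\Phi=(1-\eta)I+\eta\,\widehat{BR}_\Phi,$$ converge to the unique $\varepsilon$-GNE $\Phi_u^\star\in\Omega^{\varepsilon}$ of the system-level game $\mathcal{G}_\infty^\Phi$, with rate $$\frac{\|\Phi_{u,k}-\Phi_u^\star\|_{\ell_2}}{\|\Phi_{u,0}-\Phi_u^\star\|_{\ell_2}}\le\big((1-\eta)+\eta L_{\widehat{BR}_\Phi}\big)^k$$ from any feasible initial $\Phi_{u,0}$.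
   Context: **Data.** Players $\mathcal{P}=\{1,\dots,N_P\}$; horizon $N>1$; $\gamma\in(0,1)$; matrices $A\in\mathbb{R}^{N_x\times N_x}$, $B^p\in\mathbb{R}^{N_x\times N_u^p}$, $C^p\in\mathbb{R}^{N_z\times N_x}$, $D^{p\tilde p}\in\mathbb{R}^{N_z\times N_u^{\tilde p}}$; covariance $\Sigma_w\succ0$; noise set $\mathcal{W}\subseteq\mathbb{R}^{N_x}$; convex polyhedra $\mathcal{X}\subseteq\mathbb{R}^{N_x}$, $\mathcal{U}^p\subseteq\mathbb{R}^{N_u^p}$, $\mathcal{U}_{\mathcal{G}}\subseteq\prod_p\mathbb{R}^{N_u^p}$ with $0$ in their relative interiors. For each $p$: $(A,B^p)$ is stabilisable, $(C^p,A)$ is detectable, $D^{pp}$ has full column rank, and $(D^{p\tilde p})^{\mathsf T}C^p=0$ for all $\tilde p$. **Strategies.** Player $p$ chooses a finite-impulse-response kernel $\Phi_u^p=(\Phi_{u,n}^p)_{n=1}^{N-1}\in\mathcal{C}_u^p=\{\Phi_u^p:\Phi_{u,n}^p\in\mathcal{C}_{u,n}^p\}$, where $\mathcal{C}_{u,n}^p\subseteq\mathbb{R}^{N_u^p\times N_x}$ are compact convex sets; $\mathcal{C}_u=\prod_p\mathcal{C}_u^p$. The superscript $-p$ denotes the tuple over all players but $p$. A profile $\Phi_u=(\Phi_u^1,\dots,\Phi_u^{N_P})$ determines $\Phi_x=(\Phi_{x,n})$ by $\Phi_{x,1}=I_{N_x}$, $\Phi_{x,n+1}=A\Phi_{x,n}+\sum_{p}B^{p}\Phi_{u,n}^{p}$.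 $\|\cdot\|_{\ell_2}$ is the $\ell_2$ norm of the kernel sequence. **Feasible strategies.** $U_\Phi^p(\Phi_u^{-p})$ is the set of $\Phi_u^p\in\mathcal{C}_u^p$ such that $\Phi_{x,n}\in\mathcal{C}_{x,n}$ for given compact convex sets $\mathcal{C}_{x,n}\subseteq\mathbb{R}^{N_x\times N_x}$ ($1\le n<N$), $\|\Phi_{x,N}\|_F^2\le\gamma$, and the operational constraints $(\Phi_x*w)_n\in\mathcal{X}$, $(\Phi_u^p*w)_n\in\mathcal{U}^p$, $((\Phi_u^p*w)_n,(\Phi_u^{-p}*w)_n)\in\mathcal{U}_{\mathcal{G}}$ hold for all noise sequences $w$ with values in $\mathcal{W}$. **Game and $\varepsilon$-GNE.** In the system-level game $\mathcal{G}_\infty^\Phi$, player $p$ chooses $\Phi_u^p\in U_\Phi^p(\Phi_u^{-p})$ to minimise the infinite-horizon cost $$J^p(\Phi_u^p,\Phi_u^{-p})=\sum_{n=1}^{\infty}\Big(\|C^p\Phi_{x,n}\Sigma_w^{1/2}\|_F^2+\Big\|\sum_{\tilde p\in\mathcal{P}}D^{p\tilde p}\Phi_{u,n}^{\tilde p}\Sigma_w^{1/2}\Big\|_F^2\Big).$$ For $\varepsilon>0$, a profile $\Phi_u\in\mathcal{C}_u$ is an $\varepsilon$-GNE (approximate generalised Nash equilibrium) if $J^p(\Phi_u^p,\Phi_u^{-p})\le\min_{\Psi^p\in U_\Phi^p(\Phi_u^{-p})}J^p(\Psi^p,\Phi_u^{-p})+\varepsilon$ for every $p\in\mathcal{P}$;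 $\Omega^{\varepsilon}$ is the set of all $\varepsilon$-GNEs. Here $\varepsilon>0$ is an equilibrium gap for which the fixed points of $\widehat{BR}_\Phi$ (profiles with $\Phi_u\in\widehat{BR}_\Phi(\Phi_u)$) are contained in $\Omega^{\varepsilon}$. **Approximate best response.** $\widehat{BR}_\Phi^p(\Phi_u^{-p})$ is the set of minimisers over $\Phi_u^p\in U_\Phi^p(\Phi_u^{-p})$ of the finite-horizon cost $$\sum_{n=1}^{N-1}\Big(\|C^p\Phi_{x,n}\Sigma_w^{1/2}\|_F^2+\Big\|\sum_{\tilde p\in\mathcal{P}}D^{p\tilde p}\Phi_{u,n}^{\tilde p}\Sigma_w^{1/2}\Big\|_F^2\Big)+\|C^p\Phi_{x,N}\Sigma_w^{1/2}\|_F^2 ,$$ and $\widehat{BR}_\Phi(\Phi_u)=\widehat{BR}_\Phi^1(\Phi_u^{-1})\times\cdots\times\widehat{BR}_\Phi^{N_P}(\Phi_u^{-N_P})$. A set-valued map $F$ is $L$-Lipschitz if $\|a-b\|\le L\|x-y\|$ for all $x,y$ in its domain, $a\in F(x)$, $b\in F(y)$.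
   Formalization: Uniqueness of the ε-GNE is stated as uniqueness of the fixed point of the approximate best-response map, which lies in Ω^ε; Ω^ε itself is generally not a singleton, so literal uniqueness in Ω^ε fails. *)

(* Defs.v *)
From HB Require Import structures.
From mathcomp Require Export all_boot all_order all_algebra.
From mathcomp Require Export all_classical all_reals all_analysis.
From mathcomp Require Export complex.
Set Implicit Arguments.
Unset Strict Implicit.
Unset Printing Implicit Defensive.
Export Order.TTheory GRing.Theory Num.Theory.
Export numFieldNormedType.Exports.
Local Open Scope classical_set_scope.
Local Open Scope ring_scope.

Definition posdefmx (R : realType) n (S : 'M[R]_n) : Prop :=
  S^T = S /\ forall x : 'cV[R]_n, x != 0 -> 0 < (x^T *m S *m x) 0 0.

Definition psdmx (R : realType) n (S : 'M[R]_n) : Prop :=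
  S^T = S /\ forall x : 'cV[R]_n, 0 <= (x^T *m S *m x) 0 0.

(* S^{1/2}: the positive semidefinite square root, which exists and is unique
   when S is positive semidefinite; the default 0 is only used otherwise. *)
Definition msqrt (R : realType) n (S : 'M[R]_n) : 'M[R]_n :=
  xget 0 [set T | psdmx T /\ T *m T = S].

Definition frob2 (R : realType) m n (M : 'M[R]_(m, n)) : R :=
  \sum_i \sum_j M i j ^+ 2.

(* Discrete-time stability: every complex eigenvalue lies in the open unit
   disc. *)
Definition schur_stable (R : realType) n (M : 'M[R]_n) : Prop :=
  forall z : R[i], eigenvalue (map_mx (real_complex R) M) z -> `|z| < 1.

Definition stabilisable (R : realType) n m (A : 'M[R]_n) (B : 'M[R]_(n, m)) :
  Prop := exists K : 'M[R]_(m, n), schur_stable (A + B *m K).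

Definition detectable (R : realType) n m (C : 'M[R]_(m, n)) (A : 'M[R]_n) :
  Prop := exists K : 'M[R]_(n, m), schur_stable (A + K *m C).

Definition convex_polyhedron (R : realType) n (X : set 'cV[R]_n) : Prop :=
  exists m (H : 'M[R]_(m, n)) (h : 'cV[R]_m),
    X = [set x | forall i, (H *m x) i 0 <= h i 0].

Definition affine_hull (R : realType) n (X : set 'cV[R]_n) : set 'cV[R]_n :=
  [set y | exists k (c : 'I_k -> R) (v : 'I_k -> 'cV[R]_n),
     [/\ forall i, X (v i), \sum_i c i = 1 & y = \sum_i c i *: v i]].

Definition relative_interior (R : realType) n (X : set 'cV[R]_n) :
    set 'cV[R]_n :=
  [set x | X x /\
     exists2 r : R, 0 < r & ball x r `&` affine_hull X `<=` X].

Definition argmin d (T : Type) (Y : porderType d) (f : T -> Y) (S : set T) :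
    set T :=
  [set x | S x /\ forall y, S y -> (f x <= f y)%O].

(* The players are 'I_players.  Points of the product of the input spaces are
   stacked into one column vector, so inputUG is a set of such vectors.  The
   sets Cu_set p i and Cx_set i, for i < horizon - 1, constrain the kernel
   entries at time n = i + 1. *)
Record game_data (R : realType) := GameData {
  players : nat;
  horizon : nat;
  dimx : nat;
  dimz : nat;
  dimu : 'I_players -> nat;
  gamma : R;
  sysA : 'M[R]_dimx;
  sysB : forall p, 'M[R]_(dimx, dimu p);
  costC : 'I_players -> 'M[R]_(dimz, dimx);
  costD : 'I_players -> forall q, 'M[R]_(dimz, dimu q);
  SigmaW : 'M[R]_dimx;
  noiseW : set 'cV[R]_dimx;
  stateX : set 'cV[R]_dimx;
  inputU : forall p, set 'cV[R]_(dimu p);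
  inputUG : set 'cV[R]_(\sum_p dimu p);
  Cu_set : forall p, 'I_horizon.-1 -> set 'M[R]_(dimu p, dimx);
  Cx_set : 'I_horizon.-1 -> set 'M[R]_dimx
}.
Arguments gamma {R}.
Arguments sysA {R}.
Arguments sysB {R}.
Arguments costC {R}.
Arguments costD {R}.
Arguments SigmaW {R}.
Arguments noiseW {R}.
Arguments stateX {R}.
Arguments inputU {R}.
Arguments inputUG {R}.
Arguments Cu_set {R}.
Arguments Cx_set {R}.

Record standing_assumptions (R : realType) (G : game_data R) : Prop := {
  horizon_gt1 : (1 < horizon G)%N;
  gamma_in01 : 0 < gamma G < 1;
  SigmaW_posdef : posdefmx (SigmaW G);
  stateX_polyhedron : convex_polyhedron (stateX G);
  stateX_relint0 : relative_interior (stateX G) 0;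
  inputU_polyhedron : forall p, convex_polyhedron (inputU G p);
  inputU_relint0 : forall p, relative_interior (inputU G p) 0;
  inputUG_polyhedron : convex_polyhedron (inputUG G);
  inputUG_relint0 : relative_interior (inputUG G) 0;
  AB_stabilisable : forall p, stabilisable (sysA G) (sysB G p);
  CA_detectable : forall p, detectable (costC G p) (sysA G);
  D_full_column_rank : forall p, \rank (costD G p p) = dimu p;
  DC_orthogonal : forall p q, (costD G p q)^T *m costC G p = 0;
  Cu_compact : forall p i, compact (Cu_set G p i);
  Cu_convex : forall p i,
    @convex_set R 'M[R]_(dimu p, dimx G) (Cu_set G p i);
  Cx_compact : forall i, compact (Cx_set G i);
  Cx_convex : forall i, @convex_set R 'M[R]_(dimx G) (Cx_set G i)
}.

Section SystemLevelGame.
Context (R : realType) (G : game_data R).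

(* K i is the kernel entry at time n = i + 1, for 1 <= n <= horizon - 1. *)
Definition kernel (p : 'I_(players G)) : Type :=
  'I_(horizon G).-1 -> 'M[R]_(dimu p, dimx G).

Definition profile : Type := forall p, kernel p.

(* The entry at time n, equal to 0 outside 1 <= n < horizon. *)
Definition kernel_at p (K : kernel p) (n : nat) : 'M[R]_(dimu p, dimx G) :=
  if n is m.+1 then oapp K 0 (insub m) else 0.

(* Phi_x; the value 0 at time 0 is a convention, since kernels start at 1. *)
Fixpoint Phix (Phi : profile) (n : nat) : 'M[R]_(dimx G) :=
  match n with
  | 0 => 0
  | m.+1 => if m == 0%N then 1%:M else
      sysA G *m Phix Phi m + \sum_p sysB G p *m kernel_at (Phi p) m
  end.

Definition conv m (K : nat -> 'M[R]_(m, dimx G)) (w : nat -> 'cV[R]_(dimx G))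
    (n : nat) : 'cV[R]_m :=
  \sum_(1 <= k < n.+1) K k *m w (n - k)%N.

Definition Cu : set profile := [set Phi | forall p i, Cu_set G p i (Phi p i)].

(* The strategies of player p feasible against Phi^{-p}: dfwith Phi p Psi is the
   profile Phi with its p-th component replaced by Psi, so the value does not
   depend on the p-th component of Phi.  The same convention is used below. *)
Definition U (p : 'I_(players G)) (Phi : profile) : set (kernel p) :=
  [set Psi | let Phi' : profile := dfwith Phi p Psi in
    [/\ forall i, Cu_set G p i (Psi i),
        forall i : 'I_(horizon G).-1, Cx_set G i (Phix Phi' i.+1),
        frob2 (Phix Phi' (horizon G)) <= gamma G
      & forall w : nat -> 'cV[R]_(dimx G), (forall t, noiseW G (w t)) ->
        forall n,
        [/\ stateX G (conv (Phix Phi') w n),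
            inputU G p (conv (kernel_at Psi) w n)
          & inputUG G (\mxcol_q conv (kernel_at (Phi' q)) w n)]]].
Arguments U : clear implicits.

Definition feasible : set profile := [set Phi | forall p, U p Phi (Phi p)].

Definition state_cost (p : 'I_(players G)) (Phi : profile) (n : nat) : R :=
  frob2 (costC G p *m Phix Phi n *m msqrt (SigmaW G)).

Definition input_cost (p : 'I_(players G)) (Phi : profile) (n : nat) : R :=
  frob2 ((\sum_q costD G p q *m kernel_at (Phi q) n) *m msqrt (SigmaW G)).

(* The infinite-horizon cost may be +oo: Phi_x need not decay when A is not
   stable. *)
Definition J (p : 'I_(players G)) (Phi : profile) : \bar R :=
  (\sum_(1 <= n <oo) (state_cost p Phi n + input_cost p Phi n)%:E)%E.

Definition J_fin (p : 'I_(players G)) (Phi : profile) : R :=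
  \sum_(1 <= n < horizon G) (state_cost p Phi n + input_cost p Phi n)
  + state_cost p Phi (horizon G).

Definition is_eGNE (eps : R) : set profile :=
  [set Phi | Cu Phi /\ forall p, exists2 Psi : kernel p,
     argmin (fun Psi : kernel p => J p (dfwith Phi p Psi)) (U p Phi) Psi
     & (J p Phi <= J p (dfwith Phi p Psi) + eps%:E)%E].

Definition BR_player (p : 'I_(players G)) (Phi : profile) : set (kernel p) :=
  argmin (fun Psi : kernel p => J_fin p (dfwith Phi p Psi)) (U p Phi).
Arguments BR_player : clear implicits.

Definition BR (Phi : profile) : set profile :=
  [set Psi | forall p, BR_player p Phi (Psi p)].

Definition fixed_points (F : profile -> set profile) : set profile :=
  [set Phi | F Phi Phi].

Definition T_map (eta : R) (Phi : profile) : set profile :=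
  [set (fun p i => (1 - eta) *: Phi p i + eta *: a p i) | a in BR Phi].

(* || Phi - Psi ||_{l2} *)
Definition l2dist (Phi Psi : profile) : R :=
  Num.sqrt (\sum_p \sum_i frob2 (Phi p i - Psi p i)).

Definition set_lipschitz (L : R) (dom : set profile)
    (F : profile -> set profile) : Prop :=
  forall x y, dom x -> dom y ->
  forall a b, F x a -> F y b -> l2dist a b <= L * l2dist x y.

End SystemLevelGame.
Arguments Cu {R}.
Arguments U {R}.
Arguments feasible {R}.
Arguments J {R}.
Arguments J_fin {R}.
Arguments is_eGNE {R}.
Arguments BR_player {R}.
Arguments BR {R}.
Arguments T_map {R}.

(* Main.v *)
(* Every constraint is convex and closed in the whole profile, so the set F of
   feasible profiles is convex and compact, and best responses to points of F
   exist.  A best response b to x in F need not be feasible, but each of its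
   unilateral deviations is, and a short step from x towards b is a convex
   combination of x and these deviations, hence stays in F.  A minimiser over F
   of |x - BR(x)| is then a fixed point: as L < 1, a short step from x towards
   BR(x) would otherwise decrease this residual.  Once a fixed point is known,
   uniqueness and the rate of the iteration follow from the Lipschitz bound. *)
Require Import Defs.
From mathcomp Require Import ring lra.
Set Implicit Arguments.
Unset Strict Implicit.
Unset Printing Implicit Defensive.
Local Open Scope classical_set_scope.
Local Open Scope ring_scope.

(** * The l2 metric on profiles and convex combinations of profiles *)

Lemma minkowski_sum (R : realType) (I : finType) (u v : I -> R) :
  Num.sqrt (\sum_i (u i + v i) ^+ 2) <=
  Num.sqrt (\sum_i u i ^+ 2) + Num.sqrt (\sum_i v i ^+ 2).
Proof.
set a := Num.sqrt (\sum_i u i ^+ 2); set b := Num.sqrt (\sum_i v i ^+ 2).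
have sq0 (w : I -> R) : 0 <= \sum_i w i ^+ 2.
  by apply: sumr_ge0 => i _; exact: sqr_ge0.
have a2 : a ^+ 2 = \sum_i u i ^+ 2 by rewrite sqr_sqrtr.
have b2 : b ^+ 2 = \sum_i v i ^+ 2 by rewrite sqr_sqrtr.
have a0 : 0 <= a by exact: sqrtr_ge0.
have b0 : 0 <= b by exact: sqrtr_ge0.
have zero (w : I -> R) : \sum_i w i ^+ 2 = 0 -> forall i, w i = 0.
  move=> /psumr_eq0P w0 i; apply/eqP; rewrite -sqrf_eq0; apply/eqP/w0 => // j _.
  exact: sqr_ge0.
rewrite -(@ler_pXn2r _ 2) ?nnegrE ?sqrtr_ge0 ?addr_ge0// sqr_sqrtr//.
have [az|an0] := eqVneq a 0.
  have u0 : forall i, u i = 0 by apply: zero; rewrite -a2 az expr0n.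
  by under eq_bigr do rewrite u0 add0r; rewrite az add0r b2.
have [bz|bn0] := eqVneq b 0.
  have v0 : forall i, v i = 0 by apply: zero; rewrite -b2 bz expr0n.
  by under eq_bigr do rewrite v0 addr0; rewrite bz addr0 a2.
(* Sum [(u + v)^2 <= u^2 / s + v^2 / (1 - s)] with [s = a / (a + b)]. *)
have ab0 : 0 < a * b by rewrite mulr_gt0// lt0r ?an0 ?bn0.
rewrite -(ler_pM2l ab0).
have -> : a * b * (a + b) ^+ 2 =
    \sum_i (a + b) * (b * u i ^+ 2 + a * v i ^+ 2).
  by rewrite -mulr_sumr big_split/= -!mulr_sumr -a2 -b2; ring.
rewrite mulr_sumr; apply: ler_sum => i _; rewrite -subr_ge0.
suff -> : (a + b) * (b * u i ^+ 2 + a * v i ^+ 2) - a * b * (u i + v i) ^+ 2 =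
  (b * u i - a * v i) ^+ 2 by exact: sqr_ge0.
by ring.
Qed.

Section Distance.
Context (R : realType) (G : game_data R).
Implicit Types (x y z : profile G) (t : R).

(** For a best response [a] to [x], [mix eta x a] is the corresponding point of [T_map eta x]; the
    same operation serves for convexity and for the steps in the existence proof. *)
Definition mix t x y : profile G := fun p i => (1 - t) *: x p i + t *: y p i.

(** Flattens player, time, row and column into one finite type, so that the nested sums of [l2dist]
    become a single sum to which [minkowski_sum] applies. *)
Let index := {p : 'I_(players G) &
  ('I_(horizon G).-1 * ('I_(dimu p) * 'I_(dimx G)))%type}.

Let entry x (k : index) : R :=
  x (tag k) (tagged k).1 (tagged k).2.1 (tagged k).2.2.

Lemma l2distE x y :
  l2dist x y = Num.sqrt (\sum_k (entry x k - entry y k) ^+ 2).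
Proof.
rewrite /l2dist /frob2; congr Num.sqrt.
rewrite -(@sig_big_dep _ _ _ _ (fun p : 'I_(players G) =>
    ('I_(horizon G).-1 * ('I_(dimu p) * 'I_(dimx G)))%type) xpredT
  (fun p => xpredT)
  (fun p j => (x p j.1 j.2.1 j.2.2 - y p j.1 j.2.1 j.2.2) ^+ 2))/=.
apply: eq_bigr => p _; under eq_bigr do rewrite pair_bigA/=.
by rewrite pair_bigA/=; apply: eq_bigr => k _; rewrite !mxE.
Qed.

Lemma l2dist_ge0 x y : 0 <= l2dist x y.
Proof. exact: sqrtr_ge0. Qed.

Lemma l2dist_eq0 x y : l2dist x y = 0 -> x = y.
Proof.
move=> /eqP; rewrite l2distE sqrtr_eq0 => d0.
have {}d0 : \sum_k (entry x k - entry y k) ^+ 2 = 0.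
  by apply/eqP; rewrite eq_le d0 sumr_ge0// => k _; exact: sqr_ge0.
apply/functional_extensionality_dep => p; apply/funext => i.
apply/matrixP => k l; apply/eqP; rewrite -subr_eq0 -sqrf_eq0.
have /psumr_eq0P/(_ (Tagged _ (i, (k, l)))) := d0.
by rewrite /entry /= => -> // ? _; exact: sqr_ge0.
Qed.

Lemma l2dist0 x : l2dist x x = 0.
Proof.
rewrite l2distE big1 ?sqrtr0// => k _.
by rewrite subrr expr0n.
Qed.

Lemma l2distC x y : l2dist x y = l2dist y x.
Proof.
rewrite !l2distE; congr Num.sqrt; apply: eq_bigr => k _.
by rewrite -opprB sqrrN.
Qed.

Lemma l2dist_triangle y x z : l2dist x z <= l2dist x y + l2dist y z.
Proof.
rewrite !l2distE; apply: le_trans (minkowski_sum _ _).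
rewrite le_eqVlt; apply/orP; left; apply/eqP; congr Num.sqrt.
by apply: eq_bigr => k _; rewrite subrKA.
Qed.

(** Joint convexity of the norm. With repeated arguments and [mixxx] it bounds the length of a
    partial step, the distance left after it, and one iteration of the dynamics. *)
Lemma l2dist_mix t x y x' y' : 0 <= t <= 1 ->
  l2dist (mix t x y) (mix t x' y') <= (1 - t) * l2dist x x' + t * l2dist y y'.
Proof.
move=> /andP[t0 t1]; have t1' : 0 <= 1 - t by rewrite subr_ge0.
rewrite !l2distE.
have sqrtZ s (f : index -> R) : 0 <= s ->
    s * Num.sqrt (\sum_k f k ^+ 2) = Num.sqrt (\sum_k (s * f k) ^+ 2).
  move=> s0; under [in RHS]eq_bigr do rewrite exprMn.
  by rewrite -mulr_sumr sqrtrM ?sqr_ge0// sqrtr_sqr ger0_norm.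
rewrite !sqrtZ//; apply: le_trans (minkowski_sum _ _).
rewrite le_eqVlt; apply/orP; left; apply/eqP; congr Num.sqrt.
by apply: eq_bigr => k _; rewrite /entry !mxE; congr (_ ^+ 2); ring.
Qed.

Lemma mixxx t x : mix t x x = x.
Proof.
by apply/functional_extensionality_dep => p; apply/funext => i;
  rewrite /mix -scalerDl subrK scale1r.
Qed.

Lemma kernel_at_mix t x y p n :
  kernel_at (mix t x y p) n =
  (1 - t) *: kernel_at (x p) n + t *: kernel_at (y p) n.
Proof.
(* Outside the horizon [kernel_at] takes the default value 0, which is a mixture of two zeros. *)
have z : 0 = (1 - t) *: 0 + t *: 0 :> 'M[R]_(dimu p, dimx G).
  by rewrite !scaler0 addr0.
by case: n => [//|n] /=; case: insub.
Qed.

(** The initial value [1%:M] makes [Phix] affine rather than linear in the profile; it survives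
    because the weights sum to one. *)
Lemma Phix_mix t x y n :
  Phix (mix t x y) n = (1 - t) *: Phix x n + t *: Phix y n.
Proof.
elim: n => [|n IH] /=; first by rewrite !scaler0 addr0.
case: eqP => _; first by rewrite -scalerDl subrK scale1r.
rewrite IH mulmxDr !scalerDr -!scalemxAr addrACA; congr (_ + _).
rewrite !scaler_sumr -big_split/=; apply: eq_bigr => p _.
by rewrite kernel_at_mix mulmxDr -!scalemxAr.
Qed.

Lemma eq_conv_mix t m (K1 K2 K3 : nat -> 'M[R]_(m, dimx G)) w n :
  (forall k, K3 k = (1 - t) *: K1 k + t *: K2 k) ->
  conv K3 w n = (1 - t) *: conv K1 w n + t *: conv K2 w n.
Proof.
move=> K3E; rewrite /conv !scaler_sumr -big_split/=; apply: eq_bigr => k _.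
by rewrite K3E mulmxDl -!scalemxAl.
Qed.

(** Matches conventions: [convex_set] puts its parameter on the first point, [mix] on the second. *)
Lemma convex_setE (E : lmodType R) (A : set E) t a b : @convex_set R E A ->
  0 <= t <= 1 -> A a -> A b -> A ((1 - t) *: a + t *: b).
Proof.
move=> cA /andP[t0 t1] Aa Ab; rewrite addrC.
exact: set_mem (cA b a (Itv01 t0 t1) (mem_set Ab) (mem_set Aa)).
Qed.

Lemma polyhedron_convex n (X : set 'cV[R]_n) t a b : convex_polyhedron X ->
  0 <= t <= 1 -> X a -> X b -> X ((1 - t) *: a + t *: b).
Proof.
case=> m [H [h ->]] t01 /= ha hb i.
have := ha i; have := hb i; rewrite mulmxDr -!scalemxAr.
move: (H *m a) (H *m b) => u v; rewrite !mxE => vh uh; nra.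
Qed.

Lemma frob2_convex m n (a b : 'M[R]_(m, n)) t c :
  0 <= t <= 1 -> frob2 a <= c -> frob2 b <= c ->
  frob2 ((1 - t) *: a + t *: b) <= c.
Proof.
move=> t01 ac bc; apply: (@le_trans _ _ ((1 - t) * frob2 a + t * frob2 b)).
  rewrite /frob2 !mulr_sumr -big_split/=; apply: ler_sum => i _.
  rewrite !mulr_sumr -big_split/=; apply: ler_sum => j _.
  rewrite !mxE -subr_ge0.
  have -> : (1 - t) * a i j ^+ 2 + t * b i j ^+ 2 -
      ((1 - t) * a i j + t * b i j) ^+ 2 =
      (1 - t) * t * (a i j - b i j) ^+ 2 by ring.
  by apply: mulr_ge0; [nra|exact: sqr_ge0].
by nra.
Qed.

Lemma Cu_mix t x y : standing_assumptions G -> 0 <= t <= 1 ->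
  Cu G x -> Cu G y -> Cu G (mix t x y).
Proof.
move=> hG t01 hx hy p i.
exact: (convex_setE (@Cu_convex _ _ hG p i) t01 (hx p i) (hy p i)).
Qed.

End Distance.

(** * Continuity of matrix expressions, entry by entry *)

Lemma sum_continuous (R : realType) (T : topologicalType) (I : Type) (r : seq I)
    (P : pred I) (f : I -> T -> R) :
  (forall i, P i -> continuous (f i)) ->
  continuous (fun x => \sum_(i <- r | P i) f i x).
Proof.
move=> cf; apply: (continuous_big _ cf) => x; exact: add_continuous.
Qed.

(** A neighbourhood of a matrix contains a product of neighbourhoods of its finitely many
    entries. *)
Lemma mx_continuous (R : realType) (T : topologicalType) m n
    (f : T -> 'M[R]_(m, n)) :
  (forall i j, continuous (fun x => f x i j)) -> continuous f.
Proof.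
move=> cf x A [P fxP PA].
have : \forall y \near x, forall i j, P i j (f y i j).
  by apply: filter_forall => i; apply: filter_forall => j; exact/cf/fxP.
by apply: filterS => y; exact: PA.
Qed.

Lemma addr_continuous (R : realType) (T : topologicalType) (f g : T -> R) :
  continuous f -> continuous g -> continuous (fun x => f x + g x).
Proof. by move=> cf cg x; apply: cvgD; [exact: cf|exact: cg]. Qed.

Lemma mulr_continuous (R : realType) (T : topologicalType) (f g : T -> R) :
  continuous f -> continuous g -> continuous (fun x => f x * g x).
Proof. by move=> cf cg x; apply: cvgM; [exact: cf|exact: cg]. Qed.

Lemma addmx_continuous (R : realType) (T : topologicalType) m n
    (f g : T -> 'M[R]_(m, n)) :
  (forall i j, continuous (fun x => f x i j)) ->
  (forall i j, continuous (fun x => g x i j)) ->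
  forall i j, continuous (fun x => (f x + g x) i j).
Proof.
move=> cf cg i j; under eq_fun do rewrite mxE.
exact: addr_continuous (cf i j) (cg i j).
Qed.

Lemma mulmx_continuous (R : realType) (T : topologicalType) m n p
    (f : T -> 'M[R]_(m, n)) (g : T -> 'M[R]_(n, p)) :
  (forall i j, continuous (fun x => f x i j)) ->
  (forall i j, continuous (fun x => g x i j)) ->
  forall i j, continuous (fun x => (f x *m g x) i j).
Proof.
move=> cf cg i j; under eq_fun do rewrite mxE.
apply: sum_continuous => k _.
exact: mulr_continuous (cf i k) (cg k j).
Qed.

Lemma summx_continuous (R : realType) (T : topologicalType) m n (I : Type)
    (r : seq I) (P : pred I) (f : I -> T -> 'M[R]_(m, n)) :
  (forall k i j, continuous (fun x => f k x i j)) ->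
  forall i j, continuous (fun x => (\sum_(k <- r | P k) f k x) i j).
Proof.
move=> cf i j; under eq_fun do rewrite summxE.
by apply: sum_continuous => k _; exact: cf.
Qed.

Lemma frob2_continuous (R : realType) (T : topologicalType) m n
    (f : T -> 'M[R]_(m, n)) :
  (forall i j, continuous (fun x => f x i j)) ->
  continuous (fun x => frob2 (f x)).
Proof.
move=> cf; rewrite /frob2; apply: sum_continuous => i _.
apply: sum_continuous => j _; under eq_fun do rewrite expr2.
exact: mulr_continuous (cf i j) (cf i j).
Qed.

Lemma closed_preimage (S T : topologicalType) (f : S -> T) (A : set T) :
  continuous f -> closed A -> closed (f @^-1` A).
Proof. by move=> /continuous_closedP; exact. Qed.

Lemma polyhedron_closed (R : realType) n (X : set 'cV[R]_n) :
  convex_polyhedron X -> closed X.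
Proof.
case=> m [H [h ->]].
rewrite (_ : mkset _ =
    \bigcap_i ((fun x => (H *m x) i 0) @^-1` [set y | y <= h i 0])).
  apply: closed_bigI => i _; apply: closed_preimage; last exact: closed_le.
  by apply: mulmx_continuous => k l;
    [exact: cst_continuous|exact: coord_continuous].
by apply/seteqP; split=> x Hx i => [_|]; [exact: (Hx i)|exact: (Hx i I)].
Qed.

(** * Product topology on profiles: closed and compact constraint sets, existence of best
    responses *)

Section Topology.
Context (R : realType) (G : game_data R).

(** [kernel] and [profile] are bare function types; these spaces put the product topology on the
    same points, so that [tychonoff] applies. *)
Definition kernel_space (p : 'I_(players G)) : topologicalType :=
  prod_topology (fun _ : 'I_(horizon G).-1 => 'M[R]_(dimu p, dimx G)).

Definition profile_space : topologicalType := prod_topology kernel_space.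

Lemma profile_coord_continuous p k i j :
  continuous (fun Phi : profile_space => (Phi : profile G) p k i j).
Proof.
move=> Phi.
apply: (@continuous_comp _ _ _ (fun Phi : profile_space => Phi p k)
  (fun M : 'M[R]_(dimu p, dimx G) => M i j)); last exact: coord_continuous.
apply: (@continuous_comp _ _ _ (proj p : profile_space -> kernel_space p)
  (proj k)); exact: proj_continuous.
Qed.

Lemma kernel_at_continuous p n i j :
  continuous (fun Phi : profile_space => kernel_at (Phi p) n i j).
Proof.
case: n => [|n] /=; first by exact: cst_continuous.
case: insub => [k|] /=; first exact: profile_coord_continuous.
by exact: cst_continuous.
Qed.

Lemma Phix_continuous n i j :
  continuous (fun Phi : profile_space => Phix Phi n i j).
Proof.
elim: n i j => [|n IH] i j /=; first by exact: cst_continuous.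
case: eqP => _; first by exact: cst_continuous.
apply: addmx_continuous => {}i {}j.
  by apply: mulmx_continuous => // k l; exact: cst_continuous.
apply: summx_continuous => q; apply: mulmx_continuous => k l.
  by exact: cst_continuous.
exact: kernel_at_continuous.
Qed.

Lemma conv_continuous m (K : profile_space -> nat -> 'M[R]_(m, dimx G)) w n :
  (forall t i j, continuous (fun Phi => K Phi t i j)) ->
  forall i j, continuous (fun Phi => conv (K Phi) w n i j).
Proof.
move=> cK; apply: summx_continuous => t; apply: mulmx_continuous => // i j x.
exact: cst_continuous.
Qed.

Lemma J_fin_continuous p : continuous (J_fin G p : profile_space -> R).
Proof.
have csc n : continuous (fun Phi : profile_space => state_cost p Phi n).
  apply: frob2_continuous; apply: mulmx_continuous => [|k l]; last first.
    exact: cst_continuous.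
  apply: mulmx_continuous => [k l|]; first exact: cst_continuous.
  exact: Phix_continuous.
have cic n : continuous (fun Phi : profile_space => input_cost p Phi n).
  apply: frob2_continuous; apply: mulmx_continuous => [|k l]; last first.
    exact: cst_continuous.
  apply: summx_continuous => q; apply: mulmx_continuous => [k l|].
    exact: cst_continuous.
  exact: kernel_at_continuous.
apply: addr_continuous (csc _); apply: sum_continuous => n _.
exact: addr_continuous (csc n) (cic n).
Qed.

(** Feasibility of player p as a condition on the whole profile. By [U_dfwith], [U G p Phi] is the
    section of this set at the other players' kernels, so closedness and convexity need only be
    proved jointly. *)
Definition feasible_for (p : 'I_(players G)) : set (profile G) :=
  [set Phi | U G p Phi (Phi p)].

Lemma dfwith_id (Phi : profile G) p : dfwith Phi p (Phi p) = Phi.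
Proof. by apply/functional_extensionality_dep => q; case: dfwithP. Qed.

Lemma dfwith_idem (Phi : profile G) p (K K' : kernel p) :
  dfwith (dfwith Phi p K) p K' = dfwith Phi p K'.
Proof.
apply/functional_extensionality_dep => q.
have [<-|pq] := eqVneq p q; first by rewrite !dfwithin.
by rewrite !dfwithout.
Qed.

Lemma U_dfwith p Phi Psi : U G p Phi Psi = feasible_for p (dfwith Phi p Psi).
Proof. by rewrite /feasible_for /U /= dfwithin dfwith_idem. Qed.

Lemma feasible_forE p Phi : feasible_for p Phi <->
  [/\ forall i, Cu_set G p i (Phi p i),
     forall i : 'I_(horizon G).-1, Cx_set G i (Phix Phi i.+1),
     frob2 (Phix Phi (horizon G)) <= gamma G
   & forall w : nat -> 'cV[R]_(dimx G), (forall t, noiseW G (w t)) ->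
     forall n,
     [/\ stateX G (conv (Phix Phi) w n),
         inputU G p (conv (kernel_at (Phi p)) w n)
       & inputUG G (\mxcol_q conv (kernel_at (Phi q)) w n)]].
Proof. by rewrite /feasible_for /U /= dfwith_id. Qed.

Hypothesis hG : standing_assumptions G.

Lemma Cu_set_closed p i : closed (Cu_set G p i).
Proof. by apply: compact_closed; [exact: norm_hausdorff|exact: Cu_compact]. Qed.

Lemma Cx_set_closed i : closed (Cx_set G i).
Proof. by apply: compact_closed; [exact: norm_hausdorff|exact: Cx_compact]. Qed.

Lemma feasible_for_closed p : closed (feasible_for p : set profile_space).
Proof.
pose stateC w n : set profile_space :=
  (fun Phi => conv (Phix Phi) w n) @^-1` stateX G.
pose inputC w n : set profile_space :=
  (fun Phi => conv (kernel_at ((Phi : profile G) p)) w n) @^-1` inputU G p.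
pose jointC w n : set profile_space :=
  (fun Phi : profile_space =>
     \mxcol_q conv (kernel_at ((Phi : profile G) q)) w n) @^-1` inputUG G.
(* An intersection of preimages of closed sets under continuous maps: compact sets in a Hausdorff
   space, a closed half-line, and polyhedra. *)
rewrite (_ : feasible_for p =
  (\bigcap_i ((fun Phi : profile_space => (Phi : profile G) p i)
     @^-1` Cu_set G p i))
  `&` (\bigcap_(i : 'I_(horizon G).-1)
     ((fun Phi : profile_space => Phix Phi i.+1) @^-1` Cx_set G i))
  `&` (fun Phi : profile_space => frob2 (Phix Phi (horizon G)))
     @^-1` [set y | y <= gamma G]
  `&` (\bigcap_(w in [set w | forall t, noiseW G (w t)]) \bigcap_n
     (stateC w n `&` inputC w n `&` jointC w n))).
  apply: closedI; [apply: closedI; [apply: closedI|]|].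
  - apply: closed_bigI => i _; apply: closed_preimage (@Cu_set_closed p i).
    by apply: mx_continuous => k l; exact: profile_coord_continuous.
  - apply: closed_bigI => i _; apply: closed_preimage (@Cx_set_closed i).
    by apply: mx_continuous => k l; exact: Phix_continuous.
  - apply: closed_preimage (@closed_le R (gamma G)).
    by apply: frob2_continuous; exact: Phix_continuous.
  - apply: closed_bigI => w _; apply: closed_bigI => n _.
    apply: closedI; [apply: closedI|].
    + apply: closed_preimage (polyhedron_closed (stateX_polyhedron hG)).
      by apply: mx_continuous; apply: conv_continuous; exact: Phix_continuous.
    + apply: closed_preimage (polyhedron_closed (inputU_polyhedron hG p)).
      apply: mx_continuous; apply: conv_continuous.
      exact: kernel_at_continuous.
    + apply: closed_preimage (polyhedron_closed (inputUG_polyhedron hG)).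
      apply: mx_continuous => k l; under eq_fun do rewrite mxE.
      by apply: conv_continuous; exact: kernel_at_continuous.
apply/seteqP; split=> Phi.
  move=> /feasible_forE[hU hX hN hw]; split=> [|w Ww n _].
    by split=> //; split=> i _; [exact: hU|exact: hX].
  by have [] := hw w Ww n.
move=> [[[hU hX] hN] hw]; apply/feasible_forE; split=> // [i|i|w Ww n].
- exact: (hU i I).
- exact: (hX i I).
- by have [[? ?] ?] := hw w Ww n I.
Qed.

Lemma kernels_compact p :
  compact ([set K | forall i, Cu_set G p i (K i)] : set (kernel_space p)).
Proof. by apply: tychonoff => i; exact: Cu_compact. Qed.

Lemma Cu_space_compact : compact (Cu G : set profile_space).
Proof.
apply: (@tychonoff _ kernel_space
  (fun p => [set K | forall i, Cu_set G p i (K i)])) => p.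
exact: kernels_compact.
Qed.

(** Weierstrass: the strategy set is the preimage of a closed set under [dfwith Phi p], lies in a
    compact product, and carries a continuous cost. *)
Lemma BR_player_nonempty p (Phi : profile G) :
  U G p Phi !=set0 -> BR_player G p Phi !=set0.
Proof.
move=> U0.
have dc : continuous (dfwith Phi p : kernel_space p -> profile_space).
  exact: (@dfwith_continuous _ kernel_space).
have Ucpt : compact (U G p Phi : set (kernel_space p)).
  apply: (subclosed_compact _ (@kernels_compact p)) => [|K []//].
  rewrite (_ : U G p Phi = dfwith Phi p @^-1` feasible_for p); last first.
    by apply/funext => K; rewrite U_dfwith.
  exact: closed_preimage dc (@feasible_for_closed p).
have cJ : continuous (fun K : kernel_space p => J_fin G p (dfwith Phi p K)).
  by move=> K; apply: (continuous_comp (dc K)); exact: J_fin_continuous.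
have [K KU Kmin] := @compact_EVT_min (kernel_space p) _ _ _ U0 Ucpt
  (continuous_subspaceT cJ).
by exists K; split=> [|K' K'U]; [exact: set_mem|exact/Kmin/mem_set].
Qed.

Lemma feasible_compact : compact (feasible G : set profile_space).
Proof.
apply: (subclosed_compact _ Cu_space_compact); last first.
  by move=> Phi hPhi p; have [] := hPhi p.
rewrite (_ : feasible G = \bigcap_p feasible_for p).
  by apply: closed_bigI => p _; exact: feasible_for_closed.
by apply/seteqP; split=> Phi h p => [_|]; [exact: (h p)|exact: (h p I)].
Qed.

End Topology.

(** * Convexity of the feasible set and feasible steps towards a best response *)

Section Feasible.
Context (R : realType) (G : game_data R).
Hypothesis hG : standing_assumptions G.
Implicit Types (x y a : profile G).

(** Links the metric to the product topology, so that Lipschitz bounds in [l2dist] yield continuity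
    on [profile_space]. *)
Lemma l2dist_continuous x : continuous (fun y : profile_space G => l2dist y x).
Proof.
have cs : continuous (fun y : profile_space G =>
    \sum_p \sum_i frob2 ((y : profile G) p i - x p i)).
  apply: sum_continuous => p _; apply: sum_continuous => i _.
  apply: frob2_continuous; apply: addmx_continuous => k l.
    exact: profile_coord_continuous.
  exact: cst_continuous.
by move=> y; apply: (continuous_comp (cs y)); exact: sqrt_continuous.
Qed.

Lemma feasible_for_mix p t x y : 0 <= t <= 1 ->
  feasible_for p x -> feasible_for p y -> feasible_for p (mix t x y).
Proof.
move=> t01 /feasible_forE[xU xX xN xw] /feasible_forE[yU yX yN yw].
apply/feasible_forE; split=> [i|i||w Ww n].
- exact: (convex_setE (@Cu_convex _ _ hG p i) t01 (xU i) (yU i)).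
- by rewrite Phix_mix; exact: (convex_setE (@Cx_convex _ _ hG i) t01).
- by rewrite Phix_mix; exact: frob2_convex.
have [x1 x2 x3] := xw w Ww n; have [y1 y2 y3] := yw w Ww n.
have kE q k := kernel_at_mix t x y q k.
split.
- rewrite (eq_conv_mix _ _ (Phix_mix t x y)).
  exact: polyhedron_convex (stateX_polyhedron hG) t01 x1 y1.
- rewrite (eq_conv_mix _ _ (kE p)).
  exact: polyhedron_convex (inputU_polyhedron hG p) t01 x2 y2.
- have -> : \mxcol_q conv (kernel_at (mix t x y q)) w n =
      (1 - t) *: (\mxcol_q conv (kernel_at (x q)) w n) +
      t *: (\mxcol_q conv (kernel_at (y q)) w n).
    by apply/matrixP => k l; rewrite !mxE (eq_conv_mix _ _ (kE _)) !mxE.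
  exact: polyhedron_convex (inputUG_polyhedron hG) t01 x3 y3.
Qed.

Lemma feasible_mix t x y : 0 <= t <= 1 ->
  feasible G x -> feasible G y -> feasible G (mix t x y).
Proof. by move=> t01 hx hy p; exact: (feasible_for_mix t01 (hx p) (hy p)). Qed.

Lemma feasible_Cu x : feasible G x -> Cu G x.
Proof. by move=> hx p; have [] := hx p. Qed.

Lemma BR_Cu x a : BR G x a -> Cu G a.
Proof. by move=> ha p; have [[]] := ha p. Qed.

(* The constraints not involving p's own kernel alone are shared by all the
   players, so those met by p after deviating are met by the others too. *)
Lemma feasible_deviation x p (K : kernel p) :
  feasible G x -> U G p x K -> feasible G (dfwith x p K).
Proof.
move=> hx; rewrite U_dfwith => hK q; have [<-//|pq] := eqVneq p q.
have /feasible_forE[xU _ _ xw] := hx q.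
have /feasible_forE[_ kX kN kw] := hK.
apply/feasible_forE; split=> // [i|w Ww n]; rewrite dfwithout//.
have [_ x2 _] := xw w Ww n; have [k1 _ k3] := kw w Ww n.
by split.
Qed.

Lemma feasible_short_step x a : feasible G x -> BR G x a ->
  exists2 t : R, 0 < t <= 1 & feasible G (mix t x a).
Proof.
move=> hx ha.
have dev p : feasible G (dfwith x p (a p)).
  by apply: feasible_deviation => //; have [] := ha p.
(* Only the players in [s] move. The induction adds one player at a time by mixing with that
   player's unilateral deviation from [x]. *)
pose step t (s : seq 'I_(players G)) : profile G :=
  fun p => if p \in s then mix t x a p else x p.
suff H (s : seq 'I_(players G)) : uniq s ->
    exists2 t : R, 0 < t <= 1 & feasible G (step t s).
  have [t t01 ht] := H _ (enum_uniq 'I_(players G)).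
  exists t => //; congr (feasible G _): ht.
  by apply/functional_extensionality_dep => p; rewrite /step mem_enum.
elim: s => [_|p s IH /= /andP[ps /IH[t t01 ht]]].
  by exists 1; [lra|exact: hx].
have t1 : 0 < 1 + t by lra.
(* Mixing with weight [r] shrinks the earlier players' weight from [t] to [(1 - r) * t]. This choice
   solves [(1 - r) * t = r], so the new player gets the same weight as the others. *)
pose r := t / (1 + t).
have r01 : 0 < r <= 1.
  by rewrite /r divr_gt0 ?ler_pdivrMr//=; lra.
exists r => //.
have r01' : 0 <= r <= 1 by lra.
have := feasible_mix r01' ht (dev p); congr (feasible G _).
apply/functional_extensionality_dep => q; apply/funext => i.
rewrite /step /mix inE; have [->|qp] := eqVneq q p.
  by rewrite (negbTE ps) dfwithin.
rewrite dfwithout 1?eq_sym//=; case: ifP => _.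
  apply/matrixP => k l; rewrite !mxE.
  by rewrite /r; field; lra.
by rewrite -scalerDl subrK scale1r.
Qed.

Lemma BR_nonempty x : feasible G x -> exists a, BR G x a.
Proof.
move=> hx; have ne p : exists K, BR_player G p x K.
  by apply: (BR_player_nonempty hG); exists (x p); exact: hx.
by exists (fun p => projT1 (cid (ne p))) => p; exact: projT2 (cid (ne p)).
Qed.

(** * Existence of a fixed point under the Lipschitz bound *)

Section Lipschitz.
Variable L : R.
Hypotheses (hLip : set_lipschitz L (Cu G) (BR G)) (hL : L < 1).

(** Two triangle inequalities and the Lipschitz bound control the variation of the residual by
    [(1 + L) * l2dist y z], which tends to 0 as y tends to z. *)
Lemma BR_residual_continuous (b : profile G -> profile G) :
  (forall x, feasible G x -> BR G x (b x)) ->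
  {within (feasible G : set (profile_space G)),
    continuous ((fun x => l2dist x (b x)) : profile_space G -> R)}.
Proof.
move=> hb; apply/subspace_continuousP => x hx.
have gap y z : feasible G y -> feasible G z ->
    l2dist y (b y) - l2dist z (b z) <= (1 + L) * l2dist y z.
  move=> hy hz.
  have := hLip (feasible_Cu hy) (feasible_Cu hz) (hb y hy) (hb z hz).
  have := l2dist_triangle z y (b y); have := l2dist_triangle (b z) z (b y).
  rewrite (l2distC (b z)); lra.
apply/cvgrPdist_lt => e e0; rewrite near_withinE.
have cd : continuous (fun y : profile_space G => (1 + L) * l2dist y x).
  exact: mulr_continuous (@cst_continuous _ _ _) (@l2dist_continuous x).
have /cvgrPdist_lt/(_ e e0) := cd x.
rewrite l2dist0 mulr0; apply: filterS => y /=.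
rewrite sub0r normrN => dy hy; apply: le_lt_trans dy.
apply: le_trans (ler_norm _).
have := gap y x hy hx; have := gap x y hx hy; rewrite (l2distC x y).
by rewrite ler_norml /from_subspace /=; lra.
Qed.

Lemma fixed_point_exists x0 : feasible G x0 ->
  exists2 x, feasible G x & BR G x x.
Proof.
move=> hx0.
(* Phrased as an implication so that [choice] gives a total function. On feasible profiles it is the
   only selection: [hLip] with equal arguments makes [BR] single-valued there. *)
have ex_b x : exists y, feasible G x -> BR G x y.
  have [/BR_nonempty[a ha]|nx] := pselect (feasible G x); first by exists a.
  by exists x.
have [b hb] := choice ex_b.
have [x /set_mem hx xmin] := @compact_EVT_min (profile_space G) R _ _
  (ex_intro _ x0 hx0) (feasible_compact hG) (BR_residual_continuous hb).
exists x => //; suff xb : x = b x by rewrite [X in BR G _ X]xb; exact: hb.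
apply: l2dist_eq0; apply/eqP; rewrite eq_le l2dist_ge0 andbT leNgt.
apply/negP => d0.
have [t t01 ht] := feasible_short_step hx (hb x hx).
have := xmin _ (mem_set ht); apply/negP; rewrite -ltNge.
have t01' : 0 <= t <= 1 by lra.
(* With d the residual at x and y the short step, the residual at y is at most
   [(1 - t) * d + L * l2dist x y], while [l2dist x y <= t * d]. *)
have := l2dist_triangle (b x) (mix t x (b x)) (b (mix t x (b x))).
have := hLip (feasible_Cu hx) (feasible_Cu ht) (hb x hx) (hb _ ht).
have := l2dist_mix x (b x) (b x) (b x) t01'; rewrite mixxx l2dist0 mulr0 addr0.
have := l2dist_mix x x x (b x) t01'; rewrite mixxx l2dist0 mulr0 add0r.
set y := mix t x (b x) => h1 h2 h3 h4.
have t0 : 0 < t by lra.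
have tD : 0 < t * l2dist x (b x) by exact: mulr_gt0.
(* For [0 <= L] the new residual is at most [(1 - t * (1 - L)) * d < d]. For negative [L] the term
   [L * l2dist x y] is at most 0, and [(1 - t) * d < d] suffices. *)
have [L0|L0] := leP 0 L.
  have L1 : 0 < 1 - L by rewrite subr_gt0.
  by have := ler_wpM2l L0 h1; have := mulr_gt0 L1 tD; lra.
by have := mulr_le0_ge0 (ltW L0) (l2dist_ge0 x y); lra.
Qed.

End Lipschitz.
End Feasible.

(** * Uniqueness of the fixed point and convergence of the dynamics *)

Theorem corollary3p1 (R : realType) (G : game_data R) (eps eta L : R)
  (hG : standing_assumptions G)
  (heps : 0 < eps)
  (hfix : fixed_points (BR G) `<=` is_eGNE G eps)
  (heta : 0 < eta < 1)
  (hLip : set_lipschitz L (Cu G) (BR G))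
  (hL : L < 1)
  (Phi0 : profile G)
  (hPhi0 : feasible G Phi0) :
  exists Phistar : profile G,
    [/\ is_eGNE G eps Phistar,
        fixed_points (BR G) = [set Phistar]
      & forall Phi : nat -> profile G,
          Phi 0%N = Phi0 ->
          (forall k, T_map G eta (Phi k) (Phi k.+1)) ->
          (l2dist (Phi k) Phistar @[k --> \oo] --> (0 : R)) /\
          (forall k, l2dist (Phi k) Phistar <=
             ((1 - eta) + eta * L) ^+ k * l2dist (Phi 0%N) Phistar)].
Proof.
have [xs hxs xsfix] := fixed_point_exists hG hLip hL hPhi0.
have fix_Cu x : BR G x x -> Cu G x by exact: BR_Cu.
exists xs; split; first exact: hfix.
  apply/seteqP; split=> [x xfix|_ -> //]; apply: l2dist_eq0.
  (* Two fixed points satisfy [l2dist x xs <= L * l2dist x xs], which forces distance 0 as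
     [L < 1]. *)
  have := hLip x xs (fix_Cu x xfix) (feasible_Cu hxs) x xs xfix xsfix.
  by have := l2dist_ge0 x xs; nra.
have q1 : (1 - eta) + eta * L < 1 by nra.
move=> Phi Phi00 PhiS; set q := _ + _ in q1 *.
(* The iterates may leave the feasible set, but they stay in the convex set [Cu G], where the
   Lipschitz bound holds. *)
have PhiCu k : Cu G (Phi k).
  elim: k => [|k IH]; first by rewrite Phi00; exact: feasible_Cu.
  have [a ha <-] := PhiS k.
  by apply: (Cu_mix hG _ IH (BR_Cu ha)); lra.
(* Since [xs] is its own best response, [xs = mix eta xs xs]; comparing this with
   [mix eta (Phi k) a] gives the factor [q]. *)
have contr k : l2dist (Phi k.+1) xs <= q * l2dist (Phi k) xs.
  have [a ha <-] := PhiS k.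
  have := hLip _ _ (PhiCu k) (feasible_Cu hxs) _ _ ha xsfix.
  have eta01 : 0 <= eta <= 1 by lra.
  have := l2dist_mix (Phi k) a xs xs eta01; rewrite mixxx /mix /q.
  by nra.
have [q0|q0] := leP 0 q; last first.
  (* A negative rate forces every distance to vanish. *)
  have d0 k : l2dist (Phi k) xs = 0.
    by have := contr k; have := l2dist_ge0 (Phi k) xs;
      have := l2dist_ge0 (Phi k.+1) xs; nra.
  split=> [|k]; last by rewrite !d0 mulr0.
  by under eq_fun do rewrite d0; exact: cvg_cst.
have rate k : l2dist (Phi k) xs <= q ^+ k * l2dist (Phi 0%N) xs.
  elim: k => [|k IH]; first by rewrite expr0 mul1r.
  apply: le_trans (contr k) _.
  by rewrite exprS -mulrA ler_wpM2l.
split=> //.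
apply: (@squeeze_cvgr _ _ _ _ (fun=> 0)
  (fun k => q ^+ k * l2dist (Phi 0%N) xs)).
- by apply: nearW => k; rewrite l2dist_ge0 rate.
- exact: cvg_cst.
- rewrite -[X in _ --> X](mul0r (l2dist (Phi 0%N) xs)).
  by apply: cvgMl; apply: cvg_expr; rewrite ger0_norm.
Qed.
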